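(* Let $\Phi:[0,1]\to\mathbb R$ be symmetric about $\tfrac12$, continuous on $[0,1]$, differentiable on $(0,1)$ with $\Phi'$ increasing and continuous on $(0,1)$ and strictly concave on $(0,\tfrac12]$. Let $\omega:[0,\tfrac12]\to\mathbb R$ be continuous with $\omega(\beta)\le\tfrac14$ and $W^{(n)}(\tfrac12,\beta)\le\omega(\beta)$ for all $\beta$ for which $W^{(n)}(\tfrac12,\beta)$ is defined. Then for $\rho\in(0,1)$ and $n\ge1$, $\mathbf{MaxStab}_\Phi(\tfrac12)\le\overline\Upsilon_\rho$, where $$\overline\Upsilon_\rho:=\max_{\beta\in[0,\frac12]}\ \max_{(z_1,z_2)\in\check{\mathcal Z}}\ (1-2p-2q)\Phi(0)+2p\Phi(\tfrac12+\rho z_1)+2q\Phi(\tfrac12+\rho z_2),$$ $$p=\frac{(1-\rho)(1+\rho-4\rho^2\omega(\beta)+2\beta(1+2\rho z_2-\rho^2))}{4(1+2\rho z_1)(1+\rho z_2-\rho z_1-\rho^2)},\quad q=\frac{(1-\rho)(1+\rho-4\rho^2\omega(\beta)-2\beta(1-2\rho z_1-\rho^2))}{4(1-2\rho z_2)(1+\rho z_2-\rho z_1-\rho^2)},$$ and $\check{\mathcal Z}=\{(z_1,z_2):-\frac1{2\rho}\le z_1\le z_2\le\frac1{2\rho},\ 0\le p\le\frac14+\frac\beta2,\ 0\le q\le\frac14-\frac\beta2\}$.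
   Context: $\mathbf X$ uniform on $\{-1,1\}^n$; $\mathbf Y$ obtained by independently flipping each coordinate of $\mathbf X$ with probability $(1-\rho)/2$; $T_\rho f(\mathbf x)=\mathbb E[f(\mathbf Y)\mid\mathbf X=\mathbf x]$; $\mathbf{MaxStab}_\Phi(a)=\max\{\mathbb E[\Phi(T_\rho f(\mathbf X))]:f:\{-1,1\}^n\to\{0,1\},\mathbb Ef(\mathbf X)=a\}$. For $f:\{-1,1\}^n\to\mathbb R$, $\hat f_{\{i\}}=\mathbb E[f(\mathbf X)X_i]$, $\mathbf W_1[f]=\sum_i\hat f_{\{i\}}^2$, and $W^{(n)}(a,\beta):=\max\{\mathbf W_1[f]:f\text{ Boolean},\ \mathbb Ef=a,\ \max_{i}|\hat f_{\{i\}}|=\beta\}$. *)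

(* Defs.v *)
From HB Require Import structures.
From mathcomp Require Import all_boot all_order all_algebra.
From mathcomp Require Import all_classical all_reals all_analysis.
Set Implicit Arguments. Unset Strict Implicit. Unset Printing Implicit Defensive.
Import Order.TTheory GRing.Theory Num.Theory.
Import numFieldNormedType.Exports.
Local Open Scope classical_set_scope.
Local Open Scope ring_scope.

(* The hypercube {-1,1}^n, encoded by bits: bit b stands for chi b. *)
Definition cube (n : nat) := {ffun 'I_n -> bool}.

Section Defs.
Variable R : realType.

Definition chi (b : bool) : R := if b then -1 else 1.

Definition Ecube (n : nat) (g : cube n -> R) : R :=
  (2 ^+ n)^-1 * \sum_(x : cube n) g x.

Definition bval (n : nat) (f : cube n -> bool) (x : cube n) : R := (f x)%:R.

(* P[Y = y | X = x] when each coordinate of X is flipped independently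
   with probability (1 - rho)/2 *)
Definition noise_kernel (n : nat) (rho : R) (x y : cube n) : R :=
  \prod_(i < n) ((1 + rho * chi (x i) * chi (y i)) / 2).

Definition Trho (n : nat) (rho : R) (f : cube n -> bool) (x : cube n) : R :=
  \sum_(y : cube n) noise_kernel rho x y * bval f y.

Definition fhat1 (n : nat) (f : cube n -> bool) (i : 'I_n) : R :=
  Ecube (fun x => bval f x * chi (x i)).

Definition W1 (n : nat) (f : cube n -> bool) : R :=
  \sum_(i < n) fhat1 f i ^+ 2.

Definition maxinf (n : nat) (f : cube n -> bool) : R :=
  \big[Num.max/0]_(i < n) `|fhat1 f i|.

Definition Wset (n : nat) (a beta : R) : set R :=
  [set W1 f | f in [set f : cube n -> bool | Ecube (bval f) = a /\ maxinf f = beta]].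

Definition W_defined (n : nat) (a beta : R) : Prop :=
  exists f : cube n -> bool, Ecube (bval f) = a /\ maxinf f = beta.

(* W^{(n)}(a,beta) = max of a finite (when defined, nonempty) set *)
Definition Wn (n : nat) (a beta : R) : R := sup (Wset n a beta).

Definition MaxStab (Phi : R -> R) (rho : R) (n : nat) (a : R) : R :=
  sup [set Ecube (fun x => Phi (Trho rho f x)) |
        f in [set f : cube n -> bool | Ecube (bval f) = a]].

Definition p_of (rho om beta z1 z2 : R) : R :=
  ((1 - rho) * (1 + rho - 4 * rho ^+ 2 * om + 2 * beta * (1 + 2 * rho * z2 - rho ^+ 2)))
  / (4 * (1 + 2 * rho * z1) * (1 + rho * z2 - rho * z1 - rho ^+ 2)).

Definition q_of (rho om beta z1 z2 : R) : R :=
  ((1 - rho) * (1 + rho - 4 * rho ^+ 2 * om - 2 * beta * (1 - 2 * rho * z1 - rho ^+ 2)))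
  / (4 * (1 - 2 * rho * z2) * (1 + rho * z2 - rho * z1 - rho ^+ 2)).

(* the set \check Z (for a given beta); we require the denominators of p, q
   to be nonzero, so that p and q are defined *)
Definition Zcheck (rho om beta : R) : set (R * R) :=
  [set z | let z1 := z.1 in let z2 := z.2 in
     - (2 * rho)^-1 <= z1 /\ z1 <= z2 /\ z2 <= (2 * rho)^-1 /\
     1 + 2 * rho * z1 != 0 /\ 1 - 2 * rho * z2 != 0 /\
     0 <= p_of rho om beta z1 z2 <= 4^-1 + beta / 2 /\
     0 <= q_of rho om beta z1 z2 <= 4^-1 - beta / 2].

Definition Upsobj (Phi : R -> R) (rho om beta z1 z2 : R) : R :=
  let p := p_of rho om beta z1 z2 in
  let q := q_of rho om beta z1 z2 in
  (1 - 2 * p - 2 * q) * Phi 0 + 2 * p * Phi (2^-1 + rho * z1)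
    + 2 * q * Phi (2^-1 + rho * z2).

Definition Upsbar (Phi omega : R -> R) (rho : R) : R :=
  sup [set v | exists beta z, 0 <= beta <= 2^-1 /\
          Zcheck rho (omega beta) beta z /\
          v = Upsobj Phi rho (omega beta) beta z.1 z.2].

End Defs.

(* Main.v *)
Require Import Defs.
From HB Require Import structures.
From mathcomp Require Import all_boot all_order all_algebra.
From mathcomp Require Import all_classical all_reals all_analysis.
From mathcomp Require Import ring lra.
Import Order.TTheory GRing.Theory Num.Theory.
Import numFieldNormedType.Exports.
Local Open Scope classical_set_scope.
Local Open Scope ring_scope.

(** Write g = T_rho f and phi = Phi - Phi 0.  By symmetry phi (g) = phi (u) with
    u = |f - g|.  Split the cube according to whether f agrees with its most
    correlated coordinate, up to sign; the two classes have masses 1/2 + beta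
    and 1/2 - beta.  Fourier analysis gives M1 - M2 = beta (1 - rho) for the
    integrals M1, M2 of u over the classes and, as
    rho^(2k) <= rho^(k+2) for k >= 2, the constraint
    (2 - rho^2) E u - 2 E u^2 >= (1 - rho) (1 + rho - 4 rho^2 omega(beta)) / 2.

    Since Phi' is concave on (0, 1/2], phi lies on [0, 1] below the parabola
    that meets it at 0 and is tangent to it at a given a <= 1/2.  Integrating
    such parabolas bounds E phi(u) by its value on two-point laws on {0, A} and
    {0, C} with the same first moments and the same total second moment, where
    A + C <= 1.  The slope phi(x)/x is nonpositive and nondecreasing, so the
    constraint may be made an equality without lowering this value; then
    p = M1 / (2A) and q = M2 / (2C) at z1 = (A - 1/2) / rho and
    z2 = (1/2 - C) / rho. *)

(** * Fourier analysis of the noise operator on the cube *)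

Section Cube.
Set Implicit Arguments. Unset Strict Implicit.
Variables (R : realType) (n : nat).
Implicit Types (f : cube n -> bool) (g h : cube n -> R) (S : {set 'I_n}).
Implicit Types (rho : R) (x y : cube n).

Lemma eq_Ecube g h : g =1 h -> Ecube g = Ecube h.
Proof. by move=> gh; congr (_ * _); apply: eq_bigr. Qed.

Lemma Ecube_linear a g h :
  Ecube (fun x => a * g x + h x) = a * Ecube g + Ecube h.
Proof. by rewrite /Ecube big_split /= -mulr_sumr mulrDr mulrCA. Qed.

Lemma EcubeZ a g : Ecube (fun x => a * g x) = a * Ecube g.
Proof. by rewrite /Ecube -mulr_sumr mulrCA. Qed.

Lemma EcubeD g h : Ecube (fun x => g x + h x) = Ecube g + Ecube h.
Proof. by rewrite /Ecube big_split mulrDr. Qed.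

Lemma EcubeB g h : Ecube (fun x => g x - h x) = Ecube g - Ecube h.
Proof. by rewrite /Ecube big_split /= sumrN mulrDr mulrN. Qed.

Lemma Ecube_sum (I : finType) (F : I -> cube n -> R) :
  Ecube (fun x => \sum_i F i x) = \sum_i Ecube (F i).
Proof. by rewrite /Ecube exchange_big mulr_sumr. Qed.

Lemma Ecube_ge0 g : (forall x, 0 <= g x) -> 0 <= Ecube g.
Proof.
by move=> g0; rewrite mulr_ge0 ?invr_ge0 ?exprn_ge0 ?sumr_ge0.
Qed.

Lemma le_Ecube g h : (forall x, g x <= h x) -> Ecube g <= Ecube h.
Proof.
by move=> gh; rewrite -subr_ge0 -EcubeB Ecube_ge0// => x; rewrite subr_ge0.
Qed.

Lemma Ecube_cst (a : R) : Ecube (fun _ : cube n => a) = a.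
Proof.
rewrite /Ecube sumr_const card_ffun card_bool card_ord -[a *+ _]mulr_natl.
by rewrite natrX mulKf// expf_neq0// pnatr_eq0.
Qed.

Lemma sum_cube_prod (F : 'I_n -> bool -> R) :
  \sum_(x : cube n) \prod_i F i (x i) = \prod_i (F i true + F i false).
Proof.
by rewrite -bigA_distr_bigA; apply: eq_bigr => i _; rewrite big_bool.
Qed.

Definition walsh S (x : cube n) : R := \prod_(i in S) chi R (x i).

Definition fhat f S : R := Ecube (fun x => bval R f x * walsh S x).

Lemma walsh0 x : walsh finset.set0 x = 1.
Proof. exact: big_set0. Qed.

Lemma walsh1 i x : walsh [set i]%SET x = chi R (x i).
Proof. exact: big_set1. Qed.

Lemma fhat0 f : fhat f finset.set0 = Ecube (bval R f).
Proof. by apply: eq_Ecube => x; rewrite walsh0 mulr1. Qed.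

Lemma fhat_set1 f i : fhat f [set i]%SET = fhat1 R f i.
Proof. by apply: eq_Ecube => x; rewrite walsh1. Qed.

Lemma Ecube_chi i : Ecube (fun x : cube n => chi R (x i)) = 0.
Proof.
rewrite /Ecube; under eq_bigr do rewrite -walsh1 /walsh big_mkcond/=.
rewrite (sum_cube_prod (fun j b => if j \in [set i]%SET then chi R b else 1)).
by rewrite (bigD1 i)//= inE eqxx /chi addNr mul0r mulr0.
Qed.

(** Kernel and Walsh function are both products over coordinates, so the sum factorises; a
    coordinate contributes [rho * chi R (y i)] inside [S] and [1] outside. *)
Lemma sum_noise_walsh rho y S :
  \sum_x noise_kernel rho x y * walsh S x = rho ^+ #|S| * walsh S y.
Proof.
under eq_bigr do rewrite /walsh [X in _ * X]big_mkcond -big_split/=.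
rewrite (sum_cube_prod (fun i b => (1 + rho * chi R b * chi R (y i)) / 2 *
  (if i \in S then chi R b else 1))).
rewrite -prodr_const /walsh -big_split [RHS]big_mkcond/=.
by apply: eq_bigr => i _; rewrite /chi; case: (i \in S); case: (y i); field.
Qed.

Lemma noise_kernelE rho x y : noise_kernel rho x y =
  (2 ^+ n)^-1 * \sum_(S : {set 'I_n}) rho ^+ #|S| * walsh S x * walsh S y.
Proof.
rewrite /noise_kernel prodf_div prodr_const card_ord mulrC; congr (_ * _).
under eq_bigr do rewrite addrC.
rewrite bigA_distr; apply: eq_big => [S|S _]; first by rewrite inE.
by rewrite -big_mkcond/= 2!big_split prodr_const.
Qed.

Lemma noise_kernel_ge0 rho x y : 0 < rho < 1 -> 0 <= noise_kernel rho x y.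
Proof.
move=> /andP[r0 r1]; apply: prodr_ge0 => i _.
by rewrite /chi; case: (x i); case: (y i); lra.
Qed.

Lemma noise_kernelC rho x y : noise_kernel rho x y = noise_kernel rho y x.
Proof. by apply: eq_bigr => i _; rewrite mulrAC. Qed.

Lemma sum_noise_kernel rho x : \sum_y noise_kernel rho x y = 1.
Proof.
under eq_bigr => y do rewrite noise_kernelC -[noise_kernel _ _ _]mulr1 -(walsh0 y).
by rewrite sum_noise_walsh cards0 walsh0 expr0 mulr1.
Qed.

Lemma Trho_itv rho f x : 0 < rho < 1 -> 0 <= Trho rho f x <= 1.
Proof.
move=> rho01; rewrite /Trho sumr_ge0/=; last first.
  by move=> y _; rewrite mulr_ge0// noise_kernel_ge0.
rewrite -(sum_noise_kernel rho x) ler_sum// => y _.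
by rewrite ler_piMr ?noise_kernel_ge0// /bval; case: (f y).
Qed.

Lemma TrhoE rho f x :
  Trho rho f x = \sum_(S : {set 'I_n}) rho ^+ #|S| * fhat f S * walsh S x.
Proof.
rewrite /Trho; under eq_bigr do rewrite noise_kernelE -mulrA mulr_suml mulr_sumr.
rewrite exchange_big; apply: eq_bigr => S _ /=.
rewrite /fhat /Ecube 2!mulr_sumr mulr_suml; apply: eq_bigr => y _.
by rewrite /bval; ring.
Qed.

Lemma Ecube_Trho_walsh rho f S :
  Ecube (fun x => Trho rho f x * walsh S x) = rho ^+ #|S| * fhat f S.
Proof.
rewrite /Ecube; under eq_bigr do rewrite mulr_suml.
rewrite exchange_big /fhat /Ecube [RHS]mulrCA; congr (_ * _).
rewrite mulr_sumr; apply: eq_bigr => y _; rewrite mulrCA -sum_noise_walsh mulr_sumr.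
by apply: eq_bigr => x _; rewrite mulrAC mulrC.
Qed.

Lemma Ecube_Trho rho f : Ecube (Trho rho f) = Ecube (bval R f).
Proof.
transitivity (Ecube (fun x => Trho rho f x * walsh finset.set0 x)).
  by apply: eq_Ecube => x; rewrite walsh0 mulr1.
by rewrite Ecube_Trho_walsh cards0 mul1r fhat0.
Qed.

Lemma Ecube_Trho_chi rho f i :
  Ecube (fun x => Trho rho f x * chi R (x i)) = rho * fhat1 R f i.
Proof.
rewrite -fhat_set1 -[X in X * _]expr1 -(cards1 i) -Ecube_Trho_walsh.
by apply: eq_Ecube => x; rewrite walsh1.
Qed.

Lemma Ecube_Trho_mul rho f h : Ecube (fun x => Trho rho f x * h x) =
  \sum_(S : {set 'I_n}) rho ^+ #|S| * fhat f S * Ecube (fun x => h x * walsh S x).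
Proof.
under eq_bigr do rewrite -EcubeZ.
by rewrite -Ecube_sum; apply: eq_Ecube => x; rewrite TrhoE mulr_suml;
  apply: eq_bigr => S _; rewrite -[LHS]mulrA [walsh S x * _]mulrC.
Qed.

Lemma Ecube_mul_Trho rho f : Ecube (fun x => bval R f x * Trho rho f x) =
  \sum_(S : {set 'I_n}) rho ^+ #|S| * fhat f S ^+ 2.
Proof.
transitivity (Ecube (fun x => Trho rho f x * bval R f x)).
  by apply: eq_Ecube => x; rewrite mulrC.
by rewrite Ecube_Trho_mul; apply: eq_bigr => S _; rewrite -mulrA expr2.
Qed.

Lemma Ecube_Trho_sqr rho f : Ecube (fun x => Trho rho f x ^+ 2) =
  \sum_(S : {set 'I_n}) rho ^+ (2 * #|S|) * fhat f S ^+ 2.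
Proof.
rewrite /= (@eq_Ecube _ (fun x => Trho rho f x * Trho rho f x)) //.
rewrite Ecube_Trho_mul; apply: eq_bigr => S _.
by rewrite Ecube_Trho_walsh mul2n -addnn exprD mulrACA expr2.
Qed.

(** Levels 0 and 1 are kept exactly and the higher ones are discarded by sign. Each moment
    inequality for [T_rho f] below comes from one choice of [c]. *)
Lemma spectral_le (c : nat -> R) f : (forall k, (2 <= k)%N -> c k <= 0) ->
  \sum_(S : {set 'I_n}) c #|S| * fhat f S ^+ 2 <= c 0 * Ecube (bval R f) ^+ 2 + c 1 * W1 R f.
Proof.
move=> c_le0; rewrite (bigD1 finset.set0)//= cards0 fhat0 lerD2l.
rewrite (bigID (mem [set [set i] | i in [set: 'I_n]]%SET))/= -[leRHS]addr0.
apply: lerD.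
  rewrite le_eqVlt; apply/orP; left; apply/eqP.
  transitivity (\sum_(S in [set [set i] | i in [set: 'I_n]]%SET)
      c #|S| * fhat f S ^+ 2).
    apply: eq_bigl => S; rewrite andbC; case: imsetP => //= -[i _ ->].
    by rewrite -card_gt0 cards1.
  rewrite big_imset/=; last by move=> i j _ _ /set1_inj.
  rewrite /W1 mulr_sumr; apply: eq_big => [i|i _]; first by rewrite inE.
  by rewrite cards1 fhat_set1.
apply: sumr_le0 => S /andP[S0 S1]; rewrite mulr_le0_ge0 ?sqr_ge0// c_le0//.
rewrite ltnNge; apply/negP => S2; move: S1; have : #|S| = 1%N.
  by apply/eqP; rewrite eqn_leq S2 card_gt0.
by move=> /eqP/cards1P[i ->]; rewrite imset_f ?inE.
Qed.

End Cube.

(** * Parabolic majorants of [Phi] and the resulting two-point bounds *)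

Section Phi.
Set Implicit Arguments. Unset Strict Implicit.
Variables (R : realType) (Phi : R -> R).
Hypothesis Phi_sym : forall x : R, 0 <= x <= 1 -> Phi x = Phi (1 - x).
Hypothesis Phi_cont : {within `[0, 1], continuous Phi}.
Hypothesis Phi_der : forall x : R, 0 < x < 1 -> derivable Phi x 1.
Hypothesis dPhi_nondecr : forall x y : R, 0 < x -> x <= y -> y < 1 ->
  (derive1 Phi) x <= (derive1 Phi) y.
Hypothesis dPhi_concave : forall x y t : R, 0 < x <= 2^-1 -> 0 < y <= 2^-1 ->
  x != y -> 0 < t < 1 ->
  t * (derive1 Phi) x + (1 - t) * (derive1 Phi) y <
  (derive1 Phi) (t * x + (1 - t) * y).

Local Notation dPhi := (derive1 Phi).
Local Notation phi x := (Phi x - Phi 0).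

Lemma Phi_MVT (a b : R) : 0 <= a -> a < b -> b <= 1 ->
  exists2 c, a < c < b & Phi b - Phi a = dPhi c * (b - a).
Proof.
move=> a0 ab b1; have [||c cab ->] := @MVT _ Phi dPhi _ _ ab.
- move=> x; rewrite in_itv/= => /andP[ax xb]; rewrite derive1E.
  by apply/derivableP/Phi_der; rewrite (le_lt_trans a0 ax) (lt_le_trans xb b1).
- apply: continuous_subspaceW Phi_cont; apply: subset_itv => /=;
  by rewrite bnd_simp.
- by exists c => //; rewrite in_itv in cab.
Qed.

(** Differentiating the symmetry at its fixed point shows that this derivative equals its own
    negative. *)
Lemma dPhi_half : dPhi 2^-1 = 0.
Proof.
have dP : derivable Phi (2^-1 : R) 1 by apply: Phi_der; apply/andP; split; lra.
have H : is_derive (2^-1 : R) 1 (Phi \o (fun x => 1 - x)) (dPhi 2^-1 * (0 - 1)).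
  apply: is_derive1_comp.
  have -> : 1 - 2^-1 = 2^-1 :> R by field.
  by rewrite derive1E; apply: derivableP.
have H2 := @derive_val _ _ _ _ _ _ _ H.
have : 'D_1 Phi (2^-1 : R) = 'D_1 (Phi \o (fun x => 1 - x)) (2^-1 : R).
  apply: near_eq_derive; near=> x => /=.
  have : x \in `]0, 1[ by near: x; apply: near_in_itvoo; rewrite in_itv/=; lra.
  by rewrite in_itv/= => /andP[x0 x1]; apply: Phi_sym; rewrite !ltW.
rewrite H2 -derive1E; lra.
Unshelve. all: by end_near. Qed.

(* The slopes [phi x / x] of the chords from the origin are nondecreasing. *)
Lemma phi_chord (x y : R) : 0 < x -> x <= y -> y <= 1 -> phi x * y <= phi y * x.
Proof.
move=> x0; rewrite le_eqVlt => /predU1P[->//|xy] y1.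
have [|c1 /andP[c10 c1x] E1] := Phi_MVT (lexx 0) x0; first lra.
have [|c2 /andP[c2x c2y] E2] := @Phi_MVT x y _ xy y1; first lra.
have c12 : dPhi c1 <= dPhi c2 by apply: dPhi_nondecr; lra.
have -> : phi y = dPhi c2 * (y - x) + dPhi c1 * x.
  by move: E1 E2; lra.
rewrite E1 subr0.
have : 0 <= (dPhi c2 - dPhi c1) * ((y - x) * x).
  by rewrite !mulr_ge0 ?subr_ge0// ltW.
nra.
Qed.

Lemma phi1 : phi 1 = 0.
Proof. by rewrite (@Phi_sym 1) ?subrr ?ler01 ?lexx. Qed.

Lemma phi_le0 (x : R) : 0 < x <= 1 -> phi x <= 0.
Proof.
move=> /andP[x0 x1]; have := phi_chord x0 x1 (lexx 1).
by rewrite phi1 mul0r mulr1.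
Qed.

Lemma phi_refl (x : R) : 0 <= x <= 1 -> phi (1 - x) = phi x.
Proof. by move=> /Phi_sym ->. Qed.

(** Concavity with denominators cleared, a form that transfers at once to an affine function minus
    [dPhi]. *)
Lemma dPhi_concave3 (x y z : R) : 0 < x -> x < y -> y < z -> z <= 2^-1 ->
  (z - y) * dPhi x + (y - x) * dPhi z <= (z - x) * dPhi y.
Proof.
move=> x0 xy yz z2; have zx : 0 < z - x by lra.
have zx0 : z - x != 0 by rewrite gt_eqF.
have /= := @dPhi_concave x z ((z - y) / (z - x)).
have -> : (z - y) / (z - x) * x + (1 - (z - y) / (z - x)) * z = y by field.
have -> : 1 - (z - y) / (z - x) = (y - x) / (z - x) by field.
move=> H; have {}H : (z - y) / (z - x) * dPhi x + (y - x) / (z - x) * dPhi z < dPhi y.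
  apply: H.
  - by rewrite x0; lra.
  - by rewrite z2 andbT; lra.
  - by rewrite lt_eqF//; lra.
  - by rewrite divr_gt0 ?ltr_pdivrMr//; lra.
move: H; rewrite -(ltr_pM2l zx) => /ltW; congr (_ <= _).
by field.
Qed.

(* The derivative at [a] of [phi x / x]. *)
Definition dslope (a : R) : R := (a * dPhi a - phi a) / a ^+ 2.

(** Expanded about the point of tangency; [dslope a] is the quadratic coefficient for which the
    parabola also vanishes at [0], as [parabE] makes visible. *)
Definition parab (a x : R) : R :=
  phi a + dPhi a * (x - a) + dslope a * (x - a) ^+ 2.

Lemma parabE (a x : R) : a != 0 ->
  parab a x = x * (phi a / a + dslope a * (x - a)).
Proof. by move=> a0; rewrite /parab /dslope; field. Qed.

(* [parab a - phi] vanishes at [0] and [a], and its derivative is convex and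
   vanishes at [a]; a second zero [k] of the derivative in [`]0, a[] then fixes
   the sign pattern of the derivative on [`]0, 1/2]]. *)
Lemma phi_le_parab_half (a x : R) : 0 < a <= 2^-1 -> 0 <= x <= 2^-1 ->
  phi x <= parab a x /\ 0 <= parab a 1.
Proof.
move=> /andP[a0 a2] /andP[x0 x2]; have an0 : a != 0 by rewrite gt_eqF.
pose G y := parab a y - phi y.
pose dG y := dPhi a + 2 * dslope a * (y - a) - dPhi y.
have G0 : G 0 = 0 by rewrite /G parabE// mul0r subrr subr0.
have Ga : G a = 0 by rewrite /G parabE//; field.
have dGa : dG a = 0 by rewrite /dG; ring.
have GMVT u v : 0 <= u -> u < v -> v <= 2^-1 ->
    exists2 c, u < c < v & G v - G u = dG c * (v - u).
  move=> u0 uv v2; have [||c cuv E] := @MVT _ G dG u v uv; last first.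
    by exists c => //; rewrite in_itv in cuv.
  - have cpar : continuous (parab a : R -> R).
      move=> y; rewrite /parab.
      have : derivable (fun y : R => phi a + dPhi a * (y - a) + dslope a * (y - a) ^+ 2) y 1.
        by [].
      by move=> /derivable1_diffP/differentiable_continuous.
    apply: within_continuousB.
      by apply: continuous_subspaceT.
    apply: within_continuousB.
      apply: continuous_subspaceW Phi_cont; apply: subset_itv; rewrite bnd_simp; lra.
    by apply: continuous_subspaceT => y; exact: cvg_cst.
  - move=> y; rewrite in_itv/= => /andP[uy yv].
    have dP : is_derive y 1 Phi (dPhi y).
      by rewrite derive1E; apply/derivableP/Phi_der; lra.
    rewrite /G /parab; apply: is_derive_eq.
    rewrite /dG; rewrite /GRing.scale/=; ring.
have dG3 u v w : 0 < u -> u < v -> v < w -> w <= 2^-1 ->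
    (w - u) * dG v <= (w - v) * dG u + (v - u) * dG w.
  by move=> u0 uv vw w2; have := dPhi_concave3 u0 uv vw w2; rewrite /dG; lra.
have [k /andP[k0 ka] Ek] := GMVT _ _ (lexx 0) a0 a2.
have dGk : dG k = 0.
  by move: Ek; rewrite Ga G0 !subr0 => /esym/eqP; rewrite mulf_eq0 (negbTE an0) orbF => /eqP.
have ak : 0 < a - k by lra.
have dG_left c : 0 < c -> c < k -> 0 <= dG c.
  move=> c0 ck; have := dG3 _ _ _ c0 ck ka a2.
  by rewrite dGk dGa !mulr0 addr0 pmulr_rge0.
have dG_mid c : k < c -> c < a -> dG c <= 0.
  move=> kc ca; have := dG3 _ _ _ k0 kc ca a2.
  by rewrite dGk dGa !mulr0 addr0 pmulr_rle0.
have dG_right c : a < c -> c <= 2^-1 -> 0 <= dG c.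
  move=> ac c2; have := dG3 _ _ _ k0 ka ac c2.
  by rewrite dGk dGa !mulr0 add0r pmulr_rge0.
split; last first.
  (* A quadratic vanishing at [0] takes at [1] the value of its derivative at the midpoint, where
     [dPhi] is zero. *)
  have -> : parab a 1 = dG 2^-1.
    by rewrite /dG dPhi_half parabE// /dslope; field.
  move: a2; rewrite le_eqVlt => /predU1P[<-|a2]; first by rewrite dGa.
  exact: dG_right.
rewrite -subr_ge0 -/(G x).
have [xk|kx] := ltP x k.
  move: x0; rewrite le_eqVlt => /predU1P[<-|x0]; first by rewrite G0.
  have [c /andP[c0 cx]] := GMVT _ _ (lexx 0) x0 x2.
  by rewrite G0 !subr0 => ->; rewrite mulr_ge0 ?(ltW x0)// dG_left//; lra.
have [xa|ax|->] := ltgtP x a; last by rewrite Ga.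
  have [c /andP[xc ca]] := GMVT _ _ x0 xa a2.
  rewrite Ga sub0r -oppr_le0 => ->.
  by rewrite mulr_le0_ge0 ?subr_ge0 ?(ltW xa)// dG_mid//; lra.
have [c /andP[ac cx]] := GMVT _ _ (ltW a0) ax x2.
by rewrite Ga subr0 => ->; apply: mulr_ge0; [apply: dG_right; lra|lra].
Qed.

(** Beyond 1/2, [phi] is reflected to [1 - x], and [0 <= parab a 1] makes the parabola at least as
    large at [x] as at [1 - x]. *)
Lemma phi_le_parab (a x : R) : 0 < a <= 2^-1 -> 0 <= x <= 1 ->
  phi x <= parab a x.
Proof.
move=> a01 /andP[x0 x1]; have [x2|x2] := leP x 2^-1.
  by have [] := @phi_le_parab_half a x a01 _; rewrite ?x0.
have [|h1 h2] := @phi_le_parab_half a (1 - x) a01 _; first lra.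
rewrite -phi_refl ?x0// (le_trans h1)// -subr_ge0.
have -> : parab a x - parab a (1 - x) = (2 * x - 1) * parab a 1.
  by rewrite !parabE ?gt_eqF//; [ring|lra..].
by rewrite mulr_ge0//; lra.
Qed.

(** The parabolas tangent at [a] and at [b] each majorize [phi] at the other point of tangency;
    adding the two inequalities, divided by [b] and [a], leaves
    [0 <= (dslope a - dslope b) * (b - a)]. *)
Lemma dslope_nonincr (a b : R) : 0 < a -> a <= b -> b <= 2^-1 ->
  dslope b <= dslope a.
Proof.
move=> a0; rewrite le_eqVlt => /predU1P[->//|ab] b2.
have b0 : 0 < b by lra.
have := @phi_le_parab a b; have := @phi_le_parab b a.
rewrite !parabE ?gt_eqF// => hb ha.
have {}ha : phi b / b <= phi a / a + dslope a * (b - a).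
  by rewrite ler_pdivrMr// mulrC ha; lra.
have {}hb : phi a / a <= phi b / b + dslope b * (a - b).
  by rewrite ler_pdivrMr// mulrC hb; lra.
have ba : 0 < b - a by lra.
rewrite -(ler_pM2r ba); lra.
Qed.

(* [F] stands for the integral of [phi] against a measure on [0, 1] of mass [m],
   mean [M] and second moment [S], as far as quadratic majorants can tell. *)
Definition quad_dominated (m M S F : R) := forall l0 l1 l2 : R,
  (forall x, 0 <= x <= 1 -> phi x <= l0 + l1 * x + l2 * x ^+ 2) ->
  F <= l0 * m + l1 * M + l2 * S.

(** The parabola tangent at [c] has no constant term, so the mass drops out. The error is linear in
    [S] with slope [dslope c], so errors of two classes can cancel when their slopes agree. *)
Lemma quad_dominated_two_point (m M S F c : R) : quad_dominated m M S F ->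
  0 < c <= 2^-1 -> F <= M * (phi c / c) + dslope c * (S - M * c).
Proof.
move=> Fdom c01; have cn0 : c != 0 by rewrite gt_eqF//; lra.
have := Fdom 0 (phi c / c - dslope c * c) (dslope c).
rewrite mul0r add0r.
have -> : (phi c / c - dslope c * c) * M + dslope c * S =
  M * (phi c / c) + dslope c * (S - M * c) by ring.
apply => x x01; rewrite (le_trans (phi_le_parab c01 x01))// parabE//.
by rewrite le_eqVlt; apply/orP; left; apply/eqP; ring.
Qed.

(** A tangent parabola remains a majorant when its quadratic coefficient is raised to [g]; for [a]
    above 1/2 the reflection of the one at [1 - a] serves. The freedom in [g] allows matching the
    coefficient used for the other class. *)
Lemma quad_dominated_dirac (m M S F a g : R) : quad_dominated m M S F ->
  0 < a < 1 -> M = m * a -> dslope (Num.min a (1 - a)) <= g ->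
  F <= M * (phi a / a) + g * (S - M * a).
Proof.
move=> Fdom /andP[a0 a1] ME; rewrite {}ME in Fdom *.
have -> : m * a * (phi a / a) = m * phi a by field; rewrite gt_eqF.
have [a2|a2] := leP a (1 - a) => hg.
  have := Fdom (phi a - dPhi a * a + g * a ^+ 2) (dPhi a - 2 * g * a) g.
  have -> : (phi a - dPhi a * a + g * a ^+ 2) * m + (dPhi a - 2 * g * a) * (m * a) +
    g * S = m * phi a + g * (S - m * a * a) by ring.
  apply => x x01; rewrite (le_trans (@phi_le_parab a x _ x01))//; first lra.
  have : dslope a * (x - a) ^+ 2 <= g * (x - a) ^+ 2 by rewrite ler_wpM2r ?sqr_ge0.
  by rewrite /parab; lra.
set b := 1 - a; have ab : phi a = phi b by rewrite phi_refl//; lra.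
have := Fdom (phi b + dPhi b * a + g * a ^+ 2) (- dPhi b - 2 * g * a) g.
have -> : (phi b + dPhi b * a + g * a ^+ 2) * m + (- dPhi b - 2 * g * a) * (m * a) +
  g * S = m * phi b + g * (S - m * a * a) by ring.
rewrite ab; apply => x x01.
rewrite -phi_refl// (le_trans (@phi_le_parab b (1 - x) _ _))//; rewrite ?/b; try lra.
have : dslope b * (x - a) ^+ 2 <= g * (x - a) ^+ 2 by rewrite ler_wpM2r ?sqr_ge0.
by rewrite /parab /b; lra.
Qed.

(* Ignoring the capacities [m1], [m2], concavity of the slope would put both
   atoms at the common point [e]; a class whose mean exceeds [m e] is filled
   completely instead, and the other atom moves below [e]. *)
Lemma two_class_bound (m1 M1 S1 F1 m2 M2 S2 F2 b : R) :
  quad_dominated m1 M1 S1 F1 -> quad_dominated m2 M2 S2 F2 ->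
  0 < m1 -> M1 ^+ 2 <= m1 * S1 -> M2 ^+ 2 <= m2 * S2 ->
  0 <= S1 -> 0 <= S2 -> 0 <= M2 -> M2 <= M1 -> 0 < M1 + M2 -> M2 <= m2 ->
  S1 + S2 <= (M1 + M2) / 2 -> M1 <= m1 / 2 -> 0 <= b -> b < 2^-1 ->
  M2 <= m2 * (2^-1 + b) -> m2 * (S1 + S2) <= m2 * M1 - (M1 - M2) * M2 ->
  exists A C, [/\ 0 < A /\ 0 < C, A + C <= 1 /\ C <= 2^-1 + b,
    M1 <= m1 * A /\ M2 <= m2 * C, M1 * A + M2 * C = S1 + S2 &
    F1 + F2 <= M1 * (phi A / A) + M2 * (phi C / C)].
Proof.
move=> D1 D2 m1_gt0 cs1 cs2 S1_ge0 S2_ge0 M2_ge0 M21 M_gt0 Mm2 SM Mm1 b0 b2 Mm2b SMm.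
have M1_gt0 : 0 < M1 by lra.
have S1_gt0 : 0 < S1.
  by rewrite -(pmulr_rgt0 _ m1_gt0) (lt_le_trans _ cs1)// exprn_gt0.
pose e := (S1 + S2) / (M1 + M2).
have Me : (M1 + M2) * e = S1 + S2 by rewrite /e; field; rewrite gt_eqF.
have e_gt0 : 0 < e by rewrite divr_gt0//; lra.
have e_le : e <= 2^-1 by rewrite ler_pdivrMr//; lra.
have [M1e|M1e] := leP M1 (m1 * e); last first.
  pose A := M1 / m1; have AE : M1 = m1 * A by rewrite /A; field; rewrite gt_eqF.
  have eA : e < A by rewrite ltr_pdivlMr// mulrC.
  have A2 : A <= 2^-1 by rewrite ler_pdivrMr//; lra.
  have SA : M1 * A <= S1 by rewrite -(ler_pM2l m1_gt0) mulrA mulrAC -AE -expr2.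
  have M1eA : M1 * e < M1 * A by rewrite ltr_pM2l.
  have M2_gt0 : 0 < M2.
    by rewrite lt_neqAle M2_ge0 andbT; apply/eqP => M20; move: Me; rewrite -M20; lra.
  have m2_gt0 : 0 < m2 by lra.
  pose C := (S1 + S2 - M1 * A) / M2.
  have CE : M2 * C = S1 + S2 - M1 * A by rewrite /C; field; rewrite gt_eqF.
  have MC : M2 <= m2 * C.
    rewrite -(ler_pM2l M2_gt0) mulrCA CE -expr2 (le_trans cs2)// ler_wpM2l ?(ltW m2_gt0)//.
    lra.
  have C_gt0 : 0 < C by rewrite -(pmulr_rgt0 _ m2_gt0); lra.
  have Ce : C < e by rewrite -(ltr_pM2l M2_gt0) CE; lra.
  exists A, C; split; [by split; lra..| |lra|].
  - by split=> //; rewrite -AE.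
  (* Both classes use the coefficient [dslope C], so their second-moment errors cancel by the choice
     of [C]; it is large enough for the atom at [A] because [C < e < A <= 2^-1]. *)
  - have h1 : F1 <= M1 * (phi A / A) + dslope C * (S1 - M1 * A).
      apply: (quad_dominated_dirac D1 _ AE); first lra.
      by rewrite min_l; [apply: dslope_nonincr|]; lra.
    have h2 : F2 <= M2 * (phi C / C) + dslope C * (S2 - M2 * C).
      by apply: (quad_dominated_two_point D2); lra.
    rewrite CE in h2; lra.
have [M2e|M2e] := leP M2 (m2 * e).
  exists e, e; split; [by split; lra..|lra|].
  have e2 : 0 < e <= 2^-1 by rewrite e_gt0.
  have := quad_dominated_two_point D1 e2; have := quad_dominated_two_point D2 e2.
  have -> : S2 - M2 * e = - (S1 - M1 * e) by lra.
  rewrite mulrN; lra.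
have m2_ge0 : 0 <= m2 by lra.
have M2_gt0 : 0 < M2 by rewrite (le_lt_trans _ M2e)// mulr_ge0// ltW.
have m2_gt0 : 0 < m2 by lra.
pose C := M2 / m2; have CE : M2 = m2 * C by rewrite /C; field; rewrite gt_eqF.
have eC : e < C by rewrite ltr_pdivlMr// mulrC.
have Cb : C <= 2^-1 + b by rewrite ler_pdivrMr// mulrC.
have SC : M2 * C <= S2 by rewrite -(ler_pM2l m2_gt0) mulrA mulrAC -CE -expr2.
have M2eC : M2 * e < M2 * C by rewrite ltr_pM2l.
pose A := (S1 + S2 - M2 * C) / M1.
have AE : M1 * A = S1 + S2 - M2 * C by rewrite /A; field; rewrite gt_eqF.
have MA : M1 <= m1 * A.
  rewrite -(ler_pM2l M1_gt0) mulrCA AE -expr2 (le_trans cs1)// ler_wpM2l ?(ltW m1_gt0)//.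
  lra.
have A_gt0 : 0 < A by rewrite -(pmulr_rgt0 _ m1_gt0); lra.
have Ae : A < e by rewrite -(ltr_pM2l M1_gt0) AE; lra.
(* Multiplied by [M1], the claim reads [S1 + S2 <= M1 - (M1 - M2) * C], which is [SMm] divided by
   [m2]. *)
have AC : A + C <= 1.
  have h : S1 + S2 <= M1 - (M1 - M2) * C.
    by rewrite -(ler_pM2l m2_gt0) (le_trans SMm)// {2}CE; lra.
  by rewrite -subr_le0 -(pmulr_rle0 _ M1_gt0); lra.
exists A, C; split; [by split; lra..| |lra|].
- by split=> //; rewrite -CE.
- have h1 : F1 <= M1 * (phi A / A) + dslope A * (S1 - M1 * A).
    by apply: (quad_dominated_two_point D1); lra.
  have h2 : F2 <= M2 * (phi C / C) + dslope A * (S2 - M2 * C).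
    apply: (quad_dominated_dirac D2 _ CE); first lra.
    by have [?|?] := leP C (1 - C); apply: dslope_nonincr; lra.
  rewrite AE in h1; lra.
Qed.

End Phi.

(** * Making the quadratic constraint tight *)

Section Optimum.
Set Implicit Arguments. Unset Strict Implicit.
Variable R : realType.

(* Slack in the quadratic constraint is used up by first raising [A] as far as
   [A + C <= 1] allows and then lowering both weights by the same amount. *)
Lemma saturate_constraint (r K M1 M2 A C : R) : 1 < r -> 0 < M1 -> A + C <= 1 ->
  K <= M1 * (r - 2 * A) + M2 * (r - 2 * C) ->
  (M1 - M2) * (r - 2 * (1 - C)) <= K ->
  exists N1 N2 A', [/\ N1 - N2 = M1 - M2, (0 <= M2 -> 0 <= N2), N2 <= M2,
    A <= A' /\ A' + C <= 1 & N1 * (r - 2 * A') + N2 * (r - 2 * C) = K].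
Proof.
move=> r1 M1_gt0 AC hK hd; pose s := M1 * (r - 2 * A) + M2 * (r - 2 * C) - K.
have [s_le|s_gt] := leP s (2 * M1 * (1 - C - A)).
  have sA : A + s / (2 * M1) <= 1 - C.
    by rewrite -lerBrDl ler_pdivrMr ?mulr_gt0//; lra.
  have s0 : 0 <= s / (2 * M1) by rewrite divr_ge0 ?mulr_ge0 /s; lra.
  exists M1, M2, (A + s / (2 * M1)); split=> //; first by split; lra.
  by rewrite /s; field; rewrite gt_eqF.
(* Once the atoms sum to [1], lowering both weights by [t] lowers the left side by
   [t * (2 * r - 2)]. *)
pose t := (s - 2 * M1 * (1 - C - A)) / (2 * r - 2).
have r2 : 0 < 2 * r - 2 by lra.
have tE : t * (2 * r - 2) = s - 2 * M1 * (1 - C - A).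
  by rewrite /t; field; rewrite gt_eqF.
have t0 : 0 <= t by rewrite divr_ge0//; lra.
(* By [hd], emptying the second atom already brings the left side down to at most [K]. *)
have tM2 : t <= M2 by rewrite ler_pdivrMr// /s; lra.
exists (M1 - t), (M2 - t), (1 - C); split; [lra|lra|lra|split; lra|].
by rewrite /s in tE; lra.
Qed.

(** * The parameters p, q, z1, z2 of a pair of atoms *)

Section Atoms.
Variables (rho om beta N1 N2 A C : R).
Hypothesis rho01 : 0 < rho < 1.
Hypotheses (A_gt0 : 0 < A) (C_gt0 : 0 < C) (AC : A + C <= 1).
Hypothesis N12 : N1 - N2 = beta * (1 - rho).
Hypothesis NK : N1 * (2 - rho ^+ 2 - 2 * A) + N2 * (2 - rho ^+ 2 - 2 * C) =
  (1 - rho) * (1 + rho - 4 * rho ^+ 2 * om) / 2.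

Let z1 := (A - 2^-1) / rho.
Let z2 := (2^-1 - C) / rho.

Let rho_neq0 : rho != 0. Proof. by case/andP: rho01 => r0 _; rewrite gt_eqF. Qed.
Let rhoz1 : rho * z1 = A - 2^-1. Proof. by rewrite /z1; field. Qed.
Let rhoz2 : rho * z2 = 2^-1 - C. Proof. by rewrite /z2; field. Qed.

Let D_gt0 : 0 < 2 - rho ^+ 2 - A - C.
Proof.
case/andP: rho01 => r0 r1; have : rho ^+ 2 < 1 by rewrite exprn_ilt1// ltW.
by move: AC; lra.
Qed.

(** Cramer's rule for the linear equations [N12] and [NK] in [N1], [N2], whose determinant is
    [2 * (2 - rho ^+ 2 - A - C)] up to sign. *)
Lemma p_of_atoms : p_of rho om beta z1 z2 = N1 / (2 * A).
Proof.
rewrite /p_of -!(mulrA 2 rho) rhoz1 rhoz2.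
have -> : (1 - rho) * (1 + rho - 4 * rho ^+ 2 * om +
    2 * beta * (1 + 2 * (2^-1 - C) - rho ^+ 2)) =
    4 * N1 * (2 - rho ^+ 2 - A - C).
  transitivity (2 * ((1 - rho) * (1 + rho - 4 * rho ^+ 2 * om) / 2) +
    2 * (beta * (1 - rho)) * (2 - rho ^+ 2 - 2 * C)); first by field.
  by rewrite -NK -N12; ring.
have -> : 1 + (2^-1 - C) - (A - 2^-1) - rho ^+ 2 = 2 - rho ^+ 2 - A - C by field.
have -> : 1 + 2 * (A - 2^-1) = 2 * A by field.
by field; rewrite !gt_eqF.
Qed.

Lemma q_of_atoms : q_of rho om beta z1 z2 = N2 / (2 * C).
Proof.
rewrite /q_of -!(mulrA 2 rho) rhoz1 rhoz2.
have -> : (1 - rho) * (1 + rho - 4 * rho ^+ 2 * om -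
    2 * beta * (1 - 2 * (A - 2^-1) - rho ^+ 2)) =
    4 * N2 * (2 - rho ^+ 2 - A - C).
  transitivity (2 * ((1 - rho) * (1 + rho - 4 * rho ^+ 2 * om) / 2) -
    2 * (beta * (1 - rho)) * (2 - rho ^+ 2 - 2 * A)); first by field.
  by rewrite -NK -N12; ring.
have -> : 1 + (2^-1 - C) - (A - 2^-1) - rho ^+ 2 = 2 - rho ^+ 2 - A - C by field.
have -> : 1 - 2 * (2^-1 - C) = 2 * C by field.
by field; rewrite !gt_eqF.
Qed.

(** The atoms carry masses [N1 / A] and [N2 / C]; the upper bounds on p and q say that these fit
    into classes of masses [2^-1 + beta] and [2^-1 - beta]. *)
Lemma Zcheck_atoms : 0 <= N1 -> 0 <= N2 ->
  N1 <= (2^-1 + beta) * A -> N2 <= (2^-1 - beta) * C ->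
  Zcheck rho om beta (z1, z2).
Proof.
have [A0 C0 AC1] : [/\ 0 < A, 0 < C & A + C <= 1] by [].
have rho_gt0 : 0 < rho by case/andP: rho01.
move=> N1_ge0 N2_ge0 hA hC; rewrite /Zcheck/= p_of_atoms q_of_atoms.
rewrite -!(mulrA 2 rho) rhoz1 rhoz2.
have rhoV : rho * (2 * rho)^-1 = 2^-1 by field.
split; first by rewrite -(ler_pM2l rho_gt0) mulrN rhoz1 rhoV; lra.
split; first by rewrite -(ler_pM2l rho_gt0) rhoz1 rhoz2; move: AC; lra.
split; first by rewrite -(ler_pM2l rho_gt0) rhoz2 rhoV; lra.
split; first by rewrite gt_eqF//; lra.
split; first by rewrite gt_eqF//; lra.
by split; rewrite divr_ge0/= ?ler_pdivrMr; lra.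
Qed.

Lemma Upsobj_atoms (Phi : R -> R) :
  (forall x : R, 0 <= x <= 1 -> Phi x = Phi (1 - x)) ->
  Upsobj Phi rho om beta z1 z2 =
  Phi 0 + N1 * ((Phi A - Phi 0) / A) + N2 * ((Phi C - Phi 0) / C).
Proof.
move=> Phi_sym; rewrite /Upsobj p_of_atoms q_of_atoms rhoz1 rhoz2.
have -> : 2^-1 + (A - 2^-1) = A by ring.
have -> : 2^-1 + (2^-1 - C) = 1 - C by field.
rewrite -(Phi_sym C); last by move: (A_gt0) (C_gt0) (AC); lra.
by field; rewrite !gt_eqF.
Qed.

End Atoms.

End Optimum.

(** * Moments of |f - T_rho f| on the two classes *)

Section Stability.
Set Implicit Arguments. Unset Strict Implicit.
Variables (R : realType) (n : nat).
Implicit Types (f : cube n -> bool) (u w : cube n -> R).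

Lemma Ecube_CS w u : (forall x, 0 <= w x) ->
  Ecube (fun x => w x * u x) ^+ 2 <=
  Ecube w * Ecube (fun x => w x * u x ^+ 2).
Proof.
move=> w0; set M := Ecube (fun x => _ * u x); set S := Ecube (fun x => _ * _ ^+ 2).
have quad t : 0 <= S - 2 * t * M + t ^+ 2 * Ecube w.
  have -> : S - 2 * t * M + t ^+ 2 * Ecube w = Ecube (fun x => w x * (u x - t) ^+ 2).
    transitivity (t ^+ 2 * Ecube w + (- (2 * t) * M + S)); first by ring.
    rewrite /M /S -!Ecube_linear.
    by apply: eq_Ecube => x; ring.
  by apply: Ecube_ge0 => x; rewrite mulr_ge0 ?sqr_ge0.
have := Ecube_ge0 w0; rewrite le_eqVlt => /predU1P[m0|m_gt0].
  rewrite -m0 mul0r; have [->|Mn0] := eqVneq M 0; first by rewrite expr0n.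
  (* With zero mass the quadratic is affine in [t], and this [t] would give it the value -1. *)
  have := quad ((S + 1) / (2 * M)); rewrite -m0 mulr0 addr0.
  have -> : S - 2 * ((S + 1) / (2 * M)) * M = -1 by field.
  lra.
have := quad (M / Ecube w); rewrite -(pmulr_rge0 _ m_gt0).
have -> : Ecube w * (S - 2 * (M / Ecube w) * M + (M / Ecube w) ^+ 2 * Ecube w) =
  Ecube w * S - M ^+ 2 by field; rewrite gt_eqF.
by rewrite subr_ge0.
Qed.

Lemma quad_dominated_Ecube (Phi : R -> R) w u :
  (forall x, 0 <= w x) -> (forall x, 0 <= u x <= 1) ->
  quad_dominated Phi (Ecube w) (Ecube (fun x => w x * u x))
    (Ecube (fun x => w x * u x ^+ 2))
    (Ecube (fun x => w x * (Phi (u x) - Phi 0))).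
Proof.
move=> w0 u01 l0 l1 l2 hl; rewrite -addrA -[l2 * _]EcubeZ -!Ecube_linear.
apply: le_Ecube => x; rewrite (le_trans (ler_wpM2l (w0 x) (hl _ (u01 x))))//.
by rewrite le_eqVlt; apply/orP; left; apply/eqP; ring.
Qed.

Lemma maxinf_attained f : (0 < n)%N -> exists i, maxinf R f = `|fhat1 R f i|.
Proof.
move=> n_gt0; exists [arg max_(i > Ordinal n_gt0) `|fhat1 R f i|]%O.
by rewrite /maxinf (bigmax_eq_arg _ (Ordinal n_gt0)).
Qed.

Lemma norm_fhat1_le f i : Ecube (bval R f) = 2^-1 -> `|fhat1 R f i| <= 2^-1.
Proof.
move=> <-; have h s : s = 1 \/ s = -1 -> s * fhat1 R f i <= Ecube (bval R f).
  move=> hs; rewrite -EcubeZ; apply: le_Ecube => x.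
  rewrite /bval /chi; case: (f x); case: (x i); case: hs => ->;
  by rewrite /= ?mulr0n ?mulr1n; lra.
rewrite ler_norml; have := h 1 (or_introl erefl); have := h (-1) (or_intror erefl).
by rewrite mulN1r mul1r => h1 h2; rewrite h2 andbT lerNl.
Qed.

Lemma W1_le_Wn f : Ecube (bval R f) = 2^-1 -> W1 R f <= Wn n 2^-1 (maxinf R f).
Proof.
move=> Ef; apply: ub_le_sup; last by exists f.
exists (\sum_(i < n) 2^-1 ^+ 2) => _ [f' [Ef' _] <-]; apply: ler_sum => i _.
by rewrite -[leLHS]real_normK ?num_real// lerXn2r ?nnegrE ?norm_fhat1_le// invr_ge0.
Qed.

Lemma sqr_maxinf_le_W1 f : (0 < n)%N -> maxinf R f ^+ 2 <= W1 R f.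
Proof.
move=> /(maxinf_attained f)[i ->]; rewrite real_normK ?num_real//.
by rewrite /W1 (bigD1 i)//= lerDl sumr_ge0// => j _; rewrite sqr_ge0.
Qed.

Section Moments.
Variables (rho : R) (f : cube n -> bool) (i : 'I_n) (s : R).
Hypotheses (rho01 : 0 < rho < 1) (Ef : Ecube (bval R f) = 2^-1).
Hypothesis s_sign : s = 1 \/ s = -1.

Let b := bval R f.
Let g := Trho rho f.
Let beta := s * fhat1 R f i.
Let T := Ecube (fun x => b x * g x).
Let G := Ecube (fun x => g x ^+ 2).

Let b01 x : b x = 1 \/ b x = 0.
Proof. by rewrite /b /bval; case: (f x); [left|right]. Qed.

Let X01 (x : cube n) : s * chi R (x i) = 1 \/ s * chi R (x i) = -1.
Proof. by rewrite /chi; case: (x i); case: s_sign => ->; [right|left|left|right]; ring. Qed.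

(* Equals [`|f - T_rho f|], as [f] is Boolean. *)
Definition gap (x : cube n) : R := b x + g x - 2 * b x * g x.

(* The indicator of the event that [f] agrees with its most correlated
   coordinate [s * x_i]. *)
Definition agree (x : cube n) : R := (1 + (2 * b x - 1) * (s * chi R (x i))) / 2.

Lemma gap_itv x : 0 <= gap x <= 1.
Proof.
have := @Trho_itv R n rho f x rho01; rewrite -/g /gap.
by case: (b01 x) => ->; lra.
Qed.

Lemma agree_ge0 x : 0 <= agree x.
Proof. by rewrite /agree; case: (b01 x) => ->; case: (X01 x) => ->; lra. Qed.

Lemma agree_le1 x : 0 <= 1 - agree x.
Proof. by rewrite /agree; case: (b01 x) => ->; case: (X01 x) => ->; lra. Qed.

Lemma Ecube_agree : Ecube agree = 2^-1 + beta.
Proof.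
transitivity (s * fhat1 R f i + (- (s / 2) * Ecube (fun x : cube n => chi R (x i)) +
  Ecube (fun _ : cube n => 2^-1))); last by rewrite Ecube_chi Ecube_cst /beta; ring.
by rewrite -!Ecube_linear; apply: eq_Ecube => x; rewrite /agree /b; field.
Qed.

Lemma Ecube_gap : Ecube gap = 1 - 2 * T.
Proof.
transitivity (- 2 * T + (Ecube b + Ecube g)).
  by rewrite -EcubeD -Ecube_linear; apply: eq_Ecube => x; rewrite /gap; ring.
by rewrite Ecube_Trho Ef; field.
Qed.

Lemma Ecube_gap_sqr : Ecube (fun x => gap x ^+ 2) = 2^-1 - 2 * T + G.
Proof.
transitivity (- 2 * T + (Ecube b + G)); last by rewrite Ef; ring.
rewrite -EcubeD -Ecube_linear; apply: eq_Ecube => x; rewrite /gap.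
by case: (b01 x) => ->; ring.
Qed.

(** The indicators of the classes differ by [(2 * b x - 1) * (s * chi R (x i))], and
    [(2 * b x - 1) * gap x = b x - g x]; noise multiplies the level-one coefficient by [rho]. *)
Lemma Ecube_gap_agree :
  Ecube (fun x => agree x * gap x) - Ecube (fun x => (1 - agree x) * gap x) =
  beta * (1 - rho).
Proof.
rewrite -EcubeB.
transitivity (s * fhat1 R f i + - s * Ecube (fun x => g x * chi R (x i))).
  rewrite -[X in _ = _ + X]EcubeZ -Ecube_linear; apply: eq_Ecube => x.
  by rewrite /gap /agree -/b; case: (b01 x) => ->; field.
by rewrite Ecube_Trho_chi /beta; ring.
Qed.

Lemma Ecube_agree_split (h : cube n -> R) :
  Ecube (fun x => agree x * h x) + Ecube (fun x => (1 - agree x) * h x) = Ecube h.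
Proof. by rewrite -EcubeD; apply: eq_Ecube => x; ring. Qed.

Lemma Phi_gap (Phi : R -> R) x :
  (forall y : R, 0 <= y <= 1 -> Phi y = Phi (1 - y)) -> Phi (gap x) = Phi (g x).
Proof.
move=> Phi_sym; rewrite /gap; case: (b01 x) => ->; last by congr Phi; ring.
by rewrite (Phi_sym (g x)) ?Trho_itv//; congr Phi; ring.
Qed.

Lemma second_moment_le :
  G - rho ^+ 2 * T <= (1 - rho ^+ 2) / 4 + (1 - rho) * rho ^+ 2 * W1 R f.
Proof.
have := @spectral_le R n (fun k => rho ^+ (2 * k) - rho ^+ (2 + k)) f.
rewrite Ef muln0 muln1 expr0 addn0 expr2.
have -> : \sum_(S : {set 'I_n}) (rho ^+ (2 * #|S|) - rho ^+ (2 + #|S|)) * fhat R f S ^+ 2 =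
    G - rho ^+ 2 * T.
  rewrite /G /T Ecube_Trho_sqr Ecube_mul_Trho mulr_sumr -sumrB.
  by apply: eq_bigr => S _; rewrite exprD; ring.
move=> h; apply: le_trans (h _) _ => [k k2|].
  case/andP: rho01 => r0 r1.
  by rewrite subr_le0 ler_wiXn2l ?ltW// mul2n -addnn leq_add2r.
by rewrite le_eqVlt; apply/orP; left; apply/eqP; field.
Qed.

(** With this comparison the level-one coefficient vanishes, so [G] is controlled by [T] alone. *)
Lemma second_moment_le_cross : G - rho * T <= (1 - rho) / 4.
Proof.
have := @spectral_le R n (fun k => rho ^+ (2 * k) - rho ^+ (1 + k)) f.
have -> : \sum_(S : {set 'I_n}) (rho ^+ (2 * #|S|) - rho ^+ (1 + #|S|)) * fhat R f S ^+ 2 =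
    G - rho * T.
  rewrite /G /T Ecube_Trho_sqr Ecube_mul_Trho mulr_sumr -sumrB.
  by apply: eq_bigr => S _; rewrite exprD; ring.
rewrite Ef muln0 muln1 expr0 addn0 expr2.
move=> h; apply: le_trans (h _) _ => [k k2|].
  case/andP: rho01 => r0 r1.
  by rewrite subr_le0 ler_wiXn2l ?ltW// mul2n -addnn leq_add2r ltnW.
by rewrite le_eqVlt; apply/orP; left; apply/eqP; field.
Qed.

Lemma cross_moment_ge : 4^-1 + rho * W1 R f <= T.
Proof.
have := @spectral_le R n (fun k => - rho ^+ k) f.
have -> : \sum_(S : {set 'I_n}) (- rho ^+ #|S|) * fhat R f S ^+ 2 = - T.
  rewrite /T Ecube_mul_Trho -sumrN.
  by apply: eq_bigr => S _; ring.
rewrite Ef expr0 expr1 => h; rewrite -lerN2; apply: le_trans (h _) _ => [k k2|].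
  by rewrite oppr_le0 exprn_ge0// ltW//; case/andP: rho01.
by rewrite le_eqVlt; apply/orP; left; apply/eqP; field.
Qed.

End Moments.

End Stability.

(** * Assembling the upper bound *)

Section Bound.
Set Implicit Arguments. Unset Strict Implicit.
Variables (R : realType) (Phi omega : R -> R) (rho : R).
Hypothesis Phi_sym : forall x : R, 0 <= x <= 1 -> Phi x = Phi (1 - x).
Hypothesis Phi_cont : {within `[0, 1], continuous Phi}.
Hypothesis Phi_der : forall x : R, 0 < x < 1 -> derivable Phi x 1.
Hypothesis dPhi_nondecr : forall x y : R, 0 < x -> x <= y -> y < 1 ->
  (derive1 Phi) x <= (derive1 Phi) y.
Hypothesis dPhi_concave : forall x y t : R, 0 < x <= 2^-1 -> 0 < y <= 2^-1 ->
  x != y -> 0 < t < 1 ->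
  t * (derive1 Phi) x + (1 - t) * (derive1 Phi) y <
  (derive1 Phi) (t * x + (1 - t) * y).
Hypothesis rho01 : 0 < rho < 1.

Local Notation phi x := (Phi x - Phi 0).

Let phi_nonpos (x : R) : 0 <= x <= 1 -> phi x <= 0.
Proof.
move=> /andP[]; rewrite le_eqVlt => /predU1P[<-|x0] x1; first by rewrite subrr.
by apply: phi_le0 => //; rewrite x0.
Qed.

(** Bounds the set under the supremum in [Upsbar], so that its elements lie below that supremum:
    both arguments of [Phi] are in [0, 1], where [phi] is nonpositive. *)
Lemma Upsobj_le_Phi0 (om beta : R) z : Zcheck rho om beta z ->
  Upsobj Phi rho om beta z.1 z.2 <= Phi 0.
Proof.
have [rho_gt0 _] := andP rho01.
move=> [/= z1_ge [z12 [z2_le [_ [_ [/andP[p0 _] /andP[q0 _]]]]]]].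
rewrite -(ler_pM2l rho_gt0) in z1_ge; rewrite -(ler_pM2l rho_gt0) in z12.
rewrite -(ler_pM2l rho_gt0) in z2_le.
have rhoV : rho * (2 * rho)^-1 = 2^-1 by field; rewrite gt_eqF.
rewrite mulrN rhoV in z1_ge; rewrite rhoV in z2_le.
rewrite /Upsobj; set p := p_of _ _ _ _ _ in p0 *; set q := q_of _ _ _ _ _ in q0 *.
set A := 2^-1 + rho * z.1; set B := 2^-1 + rho * z.2.
have hA : p * phi A <= 0 by rewrite mulr_ge0_le0// phi_nonpos// /A; lra.
have hB : q * phi B <= 0 by rewrite mulr_ge0_le0// phi_nonpos// /B; lra.
lra.
Qed.

Lemma Upsobj_le_Upsbar (beta : R) z : 0 <= beta <= 2^-1 ->
  Zcheck rho (omega beta) beta z ->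
  Upsobj Phi rho (omega beta) beta z.1 z.2 <= Upsbar Phi omega rho.
Proof.
move=> beta01 Zz; apply: ub_le_sup; last by exists beta, z.
by exists (Phi 0) => _ [b [y [_ [Zy ->]]]]; apply: Upsobj_le_Phi0.
Qed.

Lemma slack_atoms_le_Upsbar (beta M1 M2 A C : R) : 0 <= beta <= 2^-1 ->
  0 < M1 -> 0 <= M2 -> M1 - M2 = beta * (1 - rho) ->
  0 < A -> 0 < C -> A + C <= 1 -> C <= 2^-1 + rho * beta ->
  M1 <= (2^-1 + beta) * A -> M2 <= (2^-1 - beta) * C -> omega beta <= 4^-1 ->
  (1 - rho) * (1 + rho - 4 * rho ^+ 2 * omega beta) / 2 <=
    M1 * (2 - rho ^+ 2 - 2 * A) + M2 * (2 - rho ^+ 2 - 2 * C) ->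
  Phi 0 + (M1 * (phi A / A) + M2 * (phi C / C)) <= Upsbar Phi omega rho.
Proof.
move=> beta01 M1_gt0 M2_ge0 dM A_gt0 C_gt0 AC Cle hA hC om4 hK.
have [rho_gt0 rho_lt1] := andP rho01; have [beta_ge0 beta_le] := andP beta01.
have rho2 : rho ^+ 2 < 1 by rewrite exprn_ilt1// ltW.
have rho2_ge0 : 0 <= rho ^+ 2 := sqr_ge0 rho.
have [||N1 [N2 [A' [dN N2_ge0 N2_le [AA' A'C] NK]]]] :=
  saturate_constraint _ M1_gt0 AC hK; first lra.
  rewrite dM; set om := omega beta in om4 *.
  have h1 : rho ^+ 2 * om <= rho ^+ 2 / 4 by rewrite ler_wpM2l.
  have h2 : rho * beta <= rho / 2 by rewrite ler_wpM2l// ltW.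
  (* The factor after [beta] is [2 * C - rho ^+ 2], at most [1 - rho ^+ 2 + rho] by [Cle]; then
     [beta <= 2^-1] and [om <= 4^-1] suffice. *)
  have h3 : beta * (2 - rho ^+ 2 - 2 * (1 - C)) <=
      2^-1 * (1 + rho - 4 * rho ^+ 2 * om).
    apply: (@le_trans _ _ (beta * (1 - rho ^+ 2 + rho))).
      by rewrite ler_wpM2l//; lra.
    apply: (@le_trans _ _ (2^-1 * (1 - rho ^+ 2 + rho))); last lra.
    by rewrite ler_wpM2r//; lra.
  have := ler_wpM2l (_ : 0 <= 1 - rho) h3; rewrite subr_ge0 (ltW rho_lt1).
  by move=> /(_ isT); lra.
have {}N2_ge0 := N2_ge0 M2_ge0.
have N1_ge0 : 0 <= N1.
  have : 0 <= beta * (1 - rho) by rewrite mulr_ge0//; lra.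
  lra.
have A'_gt0 : 0 < A' by lra.
have hA' : N1 <= (2^-1 + beta) * A'.
  have : (2^-1 + beta) * A <= (2^-1 + beta) * A' by rewrite ler_wpM2l//; lra.
  lra.
rewrite dM in dN.
have := Upsobj_le_Upsbar beta01 (Zcheck_atoms rho01 A'_gt0 C_gt0 A'C dN NK
  N1_ge0 N2_ge0 hA' (le_trans N2_le hC)).
rewrite (Upsobj_atoms rho01 A'_gt0 C_gt0 A'C dN NK Phi_sym).
apply: le_trans; rewrite addrA; apply: lerD; last first.
  apply: ler_wnM2r => //; rewrite ler_pdivrMr// mul0r phi_nonpos//; lra.
rewrite lerD2l; apply: (@le_trans _ _ (M1 * (phi A' / A'))).
  rewrite ler_wpM2l ?(ltW M1_gt0)// ler_pdivrMr// mulrAC ler_pdivlMr//.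
  by apply: phi_chord => //; lra.
by apply: ler_wnM2r; [rewrite ler_pdivrMr// mul0r phi_nonpos//; lra|lra].
Qed.

(** Pure arithmetic from here: [W], [T], [G] stand for [W1 R f], the mean of f T_rho f and the mean
    of (T_rho f)^2. *)
Lemma moments_le_Upsbar (beta W T G M1 S1 F1 M2 S2 F2 : R) :
  0 <= beta <= 2^-1 -> omega beta <= 4^-1 -> beta ^+ 2 <= W -> W <= omega beta ->
  quad_dominated Phi (2^-1 + beta) M1 S1 F1 ->
  quad_dominated Phi (2^-1 - beta) M2 S2 F2 ->
  M1 ^+ 2 <= (2^-1 + beta) * S1 -> M2 ^+ 2 <= (2^-1 - beta) * S2 ->
  0 <= S1 -> 0 <= S2 -> 0 <= M2 -> M2 <= 2^-1 - beta ->
  M1 + M2 = 1 - 2 * T -> S1 + S2 = 2^-1 - 2 * T + G ->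
  M1 - M2 = beta * (1 - rho) ->
  G - rho ^+ 2 * T <= (1 - rho ^+ 2) / 4 + (1 - rho) * rho ^+ 2 * W ->
  G - rho * T <= (1 - rho) / 4 -> 4^-1 + rho * W <= T ->
  Phi 0 + (F1 + F2) <= Upsbar Phi omega rho.
Proof.
move=> beta01 om4 betaW Wom D1 D2 cs1 cs2 S1_ge0 S2_ge0 M2_ge0 M2_le ME SE dM
  G_le G_le' T_ge.
have [rho_gt0 rho_lt1] := andP rho01; have [beta_ge0 beta_le] := andP beta01.
have rho2_lt1 : rho ^+ 2 < 1 by rewrite exprn_ilt1// ltW.
have rho2_ge0 : 0 <= rho ^+ 2 := sqr_ge0 rho.
set K := (1 - rho) * (1 + rho - 4 * rho ^+ 2 * omega beta) / 2.
have K_le : K <= (2 - rho ^+ 2) * (M1 + M2) - 2 * (S1 + S2).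
  have : (1 - rho) * rho ^+ 2 * W <= (1 - rho) * rho ^+ 2 * omega beta.
    by rewrite ler_wpM2l// mulr_ge0//; lra.
  by rewrite /K ME SE; lra.
have K_gt0 : 0 < K.
  rewrite /K divr_gt0// mulr_gt0//; first lra.
  have : rho ^+ 2 * omega beta <= rho ^+ 2 * 4^-1 by rewrite ler_wpM2l.
  lra.
have M_gt0 : 0 < M1 + M2.
  by rewrite -(@pmulr_rgt0 _ (2 - rho ^+ 2)); lra.
have rhobW : rho * beta ^+ 2 <= rho * W by rewrite ler_wpM2l// ltW.
have bb_ge0 : 0 <= beta ^+ 2 := sqr_ge0 beta.
have rb_ge0 : 0 <= rho * beta by rewrite mulr_ge0// ltW.
have rbb_ge0 : 0 <= rho * beta ^+ 2 by rewrite mulr_ge0// ltW.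
have rb_lt : rho * beta < 2^-1.
  have : rho * beta <= rho * 2^-1 by rewrite ler_wpM2l// ltW.
  lra.
have d_ge0 : 0 <= beta * (1 - rho) by rewrite mulr_ge0//; lra.
have SM : S1 + S2 <= (M1 + M2) / 2.
  have : 0 <= (1 - rho) * (T - 4^-1) by rewrite mulr_ge0//; lra.
  by rewrite SE ME; lra.
have Mm1 : M1 <= (2^-1 + beta) / 2 by lra.
(* The right side is the value of [M2] at [T = 4^-1 + rho * beta ^+ 2], a lower bound for [T]
   because [beta ^+ 2 <= W]. *)
have Mm2 : M2 <= (2^-1 - beta) * (2^-1 + rho * beta) by lra.
have SMm : (2^-1 - beta) * (S1 + S2) <= (2^-1 - beta) * M1 - (M1 - M2) * M2.
  have h1 : (2^-1 - beta) * (S1 + S2) <=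
      (2^-1 - beta) * (2^-1 - 2 * T + 4^-1 + rho * (T - 4^-1)).
    by rewrite ler_wpM2l//; lra.
  (* After [M1E] and [M2E] are substituted, the right side of [SMm] exceeds that of [h1] by exactly
     half of this quantity. *)
  have h2 : 0 <= (1 - rho) * (T - 4^-1 - rho * beta ^+ 2) by rewrite mulr_ge0//; lra.
  have M1E : M1 = 2^-1 - T + beta * (1 - rho) / 2 by lra.
  have M2E : M2 = 2^-1 - T - beta * (1 - rho) / 2 by lra.
  by apply: (le_trans h1); rewrite M1E M2E; lra.
have m1_gt0 : 0 < 2^-1 + beta by lra.
have M21 : M2 <= M1 by lra.
have [A [C [[A_gt0 C_gt0] [AC C_le] [hA hC] SAC F_le]]] :=
  two_class_bound Phi_sym Phi_cont Phi_der dPhi_concave D1 D2 m1_gt0 cs1 cs2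
    S1_ge0 S2_ge0 M2_ge0 M21 M_gt0 M2_le SM Mm1 rb_ge0 rb_lt Mm2 SMm.
apply: (@le_trans _ _ (Phi 0 + (M1 * (phi A / A) + M2 * (phi C / C)))).
  by rewrite lerD2l.
apply: (slack_atoms_le_Upsbar beta01) => //; first lra.
by rewrite -/K; move: K_le; rewrite -SAC; lra.
Qed.

Lemma Ecube_Phi_le_Upsbar (n : nat) (f : cube n -> bool) : (0 < n)%N ->
  (forall beta, 0 <= beta <= 2^-1 -> omega beta <= 4^-1) ->
  (forall beta, W_defined n 2^-1 beta -> Wn n 2^-1 beta <= omega beta) ->
  Ecube (bval R f) = 2^-1 ->
  Ecube (fun x => Phi (Trho rho f x)) <= Upsbar Phi omega rho.
Proof.
move=> n_gt0 om4 omW Ef; have [i fi] := maxinf_attained R f n_gt0.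
have [rho_gt0 rho_lt1] := andP rho01.
have rho2_lt1 : rho ^+ 2 < 1 by rewrite exprn_ilt1// ltW.
have rho2_ge0 : 0 <= rho ^+ 2 := sqr_ge0 rho.
set beta := maxinf R f in fi.
have beta01 : 0 <= beta <= 2^-1 by rewrite fi normr_ge0 norm_fhat1_le.
have [s [s_sign sE]] : exists s : R, (s = 1 \/ s = -1) /\ s * fhat1 R f i = beta.
  rewrite fi; case: (ger0P (fhat1 R f i)) => _; [exists 1|exists (-1)].
    by rewrite mul1r; split=> //; left.
  by rewrite mulN1r; split=> //; right.
have W1om : W1 R f <= omega beta.
  by rewrite (le_trans (W1_le_Wn Ef))// omW//; exists f.
have betaW : beta ^+ 2 <= W1 R f := sqr_maxinf_le_W1 R f n_gt0.
have {}om4 := om4 _ beta01.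
pose u := gap rho f; pose w := agree f i s; pose v x : R := 1 - w x.
have w0 : forall x, 0 <= w x := agree_ge0 f i s_sign.
have v0 : forall x, 0 <= v x := agree_le1 f i s_sign.
have u01 : forall x, 0 <= u x <= 1 := gap_itv f rho01.
have u0 x : 0 <= u x by have /andP[] := u01 x.
have D1 := quad_dominated_Ecube (Phi := Phi) w0 u01.
have D2 := quad_dominated_Ecube (Phi := Phi) v0 u01.
have cs1 := Ecube_CS u w0; have cs2 := Ecube_CS u v0.
have S1_ge0 : 0 <= Ecube (fun x => w x * u x ^+ 2).
  by apply: Ecube_ge0 => x; rewrite mulr_ge0 ?sqr_ge0.
have S2_ge0 : 0 <= Ecube (fun x => v x * u x ^+ 2).
  by apply: Ecube_ge0 => x; rewrite mulr_ge0 ?sqr_ge0.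
have M2_ge0 : 0 <= Ecube (fun x => v x * u x).
  by apply: Ecube_ge0 => x; rewrite mulr_ge0.
have M2_le : Ecube (fun x => v x * u x) <= Ecube v.
  by apply: le_Ecube => x; rewrite ler_piMr//; have /andP[] := u01 x.
have m1E : Ecube w = 2^-1 + beta by rewrite (Ecube_agree f i s) sE.
have m2E : Ecube v = 2^-1 - beta by rewrite /v EcubeB Ecube_cst m1E; field.
rewrite m1E in D1 cs1; rewrite m2E in D2 cs2 M2_le.
have -> : Ecube (fun x => Phi (Trho rho f x)) = Phi 0 +
    (Ecube (fun x => w x * (Phi (u x) - Phi 0)) +
     Ecube (fun x => v x * (Phi (u x) - Phi 0))).
  rewrite (Ecube_agree_split f i s (fun x => Phi (u x) - Phi 0)).
  rewrite -[X in X + _](@Ecube_cst _ n) -EcubeD; apply: eq_Ecube => x.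
  by rewrite (Phi_gap f rho01 x Phi_sym) addrC subrK.
apply: (moments_le_Upsbar beta01 om4 betaW W1om D1 D2 cs1 cs2 S1_ge0 S2_ge0
  M2_ge0 M2_le _ _ _ (second_moment_le rho01 Ef) (second_moment_le_cross rho01 Ef)
  (cross_moment_ge rho01 Ef)).
- by rewrite (Ecube_agree_split f i s u) Ecube_gap.
- by rewrite (Ecube_agree_split f i s (fun x => u x ^+ 2)) Ecube_gap_sqr.
- by rewrite Ecube_gap_agree sE.
Qed.

End Bound.

(** A dictator function; it makes the set under the supremum in [MaxStab] nonempty, as [ge_sup]
    requires. *)
Lemma balanced_cube (R : realType) (n : nat) : (0 < n)%N ->
  exists f : cube n -> bool, Ecube (bval R f) = 2^-1.
Proof.
move=> n_gt0; exists (fun x => x (Ordinal n_gt0)).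
transitivity (- 2^-1 * Ecube (fun x : cube n => chi R (x (Ordinal n_gt0))) +
  Ecube (fun _ : cube n => 2^-1 : R)); last by rewrite Ecube_chi Ecube_cst mulr0 add0r.
rewrite -Ecube_linear; apply: eq_Ecube => x; rewrite /bval /chi.
by case: (x _); rewrite /= ?mulr0n ?mulr1n; field.
Qed.

Theorem theorem3p6 (R : realType) (Phi omega : R -> R) (rho : R) (n : nat) :
  (* Phi symmetric about 1/2 *)
  (forall x, 0 <= x <= 1 -> Phi x = Phi (1 - x)) ->
  (* Phi continuous on [0,1] *)
  {within `[0, 1], continuous Phi} ->
  (* Phi differentiable on (0,1) *)
  (forall x, 0 < x < 1 -> derivable Phi x 1) ->
  (* Phi' increasing on (0,1) *)
  (forall x y, 0 < x -> x <= y -> y < 1 -> (derive1 Phi) x <= (derive1 Phi) y) ->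
  (* Phi' continuous on (0,1) *)
  {within `]0, 1[, continuous (derive1 Phi)} ->
  (* Phi' strictly concave on (0,1/2] *)
  (forall x y t, 0 < x <= 2^-1 -> 0 < y <= 2^-1 -> x != y -> 0 < t < 1 ->
     t * (derive1 Phi) x + (1 - t) * (derive1 Phi) y < (derive1 Phi) (t * x + (1 - t) * y)) ->
  (* omega continuous on [0,1/2] with omega <= 1/4 *)
  {within `[0, 2^-1], continuous omega} ->
  (forall beta, 0 <= beta <= 2^-1 -> omega beta <= 4^-1) ->
  (* W^{(n)}(1/2, beta) <= omega(beta) whenever it is defined *)
  (forall beta, W_defined n 2^-1 beta ->
     Wn n 2^-1 beta <= omega beta) ->
  0 < rho < 1 -> (1 <= n)%N ->
  MaxStab Phi rho n 2^-1 <= Upsbar Phi omega rho.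
Proof.
move=> Phi_sym Phi_cont Phi_der dPhi_nondecr _ dPhi_concave _ om4 omW rho01 n_gt0.
have [f0 Ef0] := @balanced_cube R n n_gt0.
apply: ge_sup; first by exists (Ecube (fun x => Phi (Trho rho f0 x))), f0.
by move=> _ [f Ef <-]; apply: Ecube_Phi_le_Upsbar.
Qed.
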